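(* Let $(X,\|\cdot\|)$ be a normed space and $p>1$. Then the following assertions hold: (i) $F(p;0)=\left\{(\mu_1,\dots,\mu_n) : \mu_1,\dots,\mu_n>0 \text{ and } \sum_{i=1}^n\mu_i^{\frac{1}{p-1}}\leq 1\right\}$; (ii) $F(p;k)=\varnothing$ for all $k=1,\dots,n$; (iii) $F(p)=F(p;0)$.
   Context: For a normed space $(X,\|\cdot\|)$, a positive integer $n$ and $p>0$, let $F(p)$ be the set of all $n$-tuples $(\mu_1,\dots,\mu_n)\in\mathbb{R}^n$ (with all $\mu_i\neq 0$, so that the fractions make sense) such that $$\left\|\sum_{i=1}^n x_i\right\|^p\leq\sum_{i=1}^n\frac{\|x_i\|^p}{\mu_i}\quad\text{for all } x_1,\dots,x_n\in X.$$ For $k=0,1,\dots,n$, let $F(p;k)$ be the subset of those $(\mu_1,\dots,\mu_n)\in F(p)$ for which exactly $k$ of the numbers $\mu_1,\dots,\mu_n$ are negative.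
   Formalization: The normed space X is assumed to be nonzero; for X = {0} the defining inequality reads 0 ≤ 0, so F(p) consists of all tuples with nonzero entries and the assertions fail. *)

(* Defs.v *)
From mathcomp Require Import all_boot all_order all_algebra.
From mathcomp Require Import all_classical all_reals all_analysis.

Set Implicit Arguments.
Unset Strict Implicit.
Unset Printing Implicit Defensive.

Import Order.TTheory GRing.Theory Num.Theory.
Import numFieldNormedType.Exports.

Local Open Scope classical_set_scope.
Local Open Scope ring_scope.

(* [t `^ p] is the real power [powR]; for [p != 0] it satisfies [0 `^ p = 0],
   so it is the usual power of a nonnegative number when [0 < p]. *)
Definition Fset (R : realType) (X : normedModType R) (n : nat) (p : R) :
    set 'rV[R]_n :=
  [set mu | (forall i, mu ord0 i != 0) /\
    forall x : 'I_n -> X,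
      `|\sum_(i < n) x i| `^ p <= \sum_(i < n) `|x i| `^ p / mu ord0 i].

Definition Fset_neg (R : realType) (X : normedModType R) (n : nat) (p : R)
    (k : nat) : set 'rV[R]_n :=
  [set mu | Fset X p mu /\ #|[pred i : 'I_n | mu ord0 i < 0]| = k].

(* Main.v *)
Require Import Defs.
From mathcomp Require Import all_boot all_order all_algebra.
From mathcomp Require Import all_classical all_reals all_analysis.
From mathcomp Require Import ring lra.

Import Order.TTheory GRing.Theory Num.Theory.
Import numFieldNormedType.Exports.

Local Open Scope classical_set_scope.
Local Open Scope ring_scope.

(** Negative weights are impossible: testing the inequality on a family with a
    single nonzero vector [v] gives [`|v| `^ p <= `|v| `^ p / mu_i], so
    [1 <= mu_i^-1] and [mu_i > 0] ([Fset_weight_gt0]).  Hence [F(p)] coincides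
    with [F(p; 0)], the other [F(p; k)] are empty, and what remains is to
    decide which positive tuples are admissible.

    For those, put [w_i = mu_i `^ (1 / (p - 1))], so that
    [mu_i = w_i `^ (p - 1)].  The vectors [x_i = w_i *: v] are the extremal
    ones: with [S] the sum of the [w_i], they turn the inequality into
    [S `^ p <= S], that is [S <= 1] ([Fset_weight_sum_le1]).  Conversely,
    writing [`|x_i| = w_i * (`|x_i| / w_i)], the triangle inequality followed
    by Jensen's inequality for [t `^ p] with weights [w_i] of total mass at
    most [1] ([powR_sum_subconvex]) gives
    [`|\sum_i x_i| `^ p <= \sum_i w_i * (`|x_i| / w_i) `^ p], and each
    summand equals [`|x_i| `^ p / mu_i] ([weights_in_Fset]). *)

(** The graph of [powR ^~ p] lies above its tangent at [s].  This is Young's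
    inequality for the product [a * s `^ (p - 1)], with exponents [p] and
    [p / (p - 1)], multiplied by [p]. *)
Lemma powR_ge_tangent (R : realType) (p a s : R) :
  1 < p -> 0 <= a -> 0 <= s ->
  p * s `^ (p - 1) * a - (p - 1) * s `^ p <= a `^ p.
Proof.
move=> p1 a0 s0.
have p0 : 0 < p by lra.
have pB0 : 0 < p - 1 by lra.
have q0 : 0 < p / (p - 1) by rewrite divr_gt0.
have pq : p^-1 + (p / (p - 1))^-1 = 1 by field; lra.
have := conjugate_powR a0 (powR_ge0 s (p - 1)) p0 q0 pq.
rewrite -powRrM mulrCA mulfV ?gt_eqF// mulr1 => young.
have := ler_wpM2l (ltW p0) young.
rewrite (_ : p * (a `^ p / p + s `^ p / (p / (p - 1))) =
             a `^ p + (p - 1) * s `^ p); last by field; lra.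
rewrite (_ : p * s `^ (p - 1) * a = p * (a * s `^ (p - 1))); last by ring.
lra.
Qed.

(** Jensen's inequality for [powR ^~ p].  A total weight below [1] is allowed
    because the missing mass can be placed at the point [0], where the
    function vanishes. *)
Lemma powR_sum_subconvex (R : realType) (I : finType) (p : R) (w a : I -> R) :
  1 < p -> (forall i, 0 <= w i) -> (forall i, 0 <= a i) ->
  \sum_i w i <= 1 ->
  (\sum_i w i * a i) `^ p <= \sum_i w i * a i `^ p.
Proof.
move=> p1 w0 a0 w1.
set s := \sum_i w i * a i; set W := \sum_i w i in w1 *.
have s0 : 0 <= s by apply: sumr_ge0 => i _; rewrite mulr_ge0.
(* Average the tangent bounds taken at [s], the barycentre once the mass
   [1 - W] is placed at [0]. *)
have tangent_sum :
    p * s `^ (p - 1) * s - (p - 1) * s `^ p * W <= \sum_i w i * a i `^ p.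
  rewrite {2}/s /W !mulr_sumr -sumrB; apply: ler_sum => i _.
  have := ler_wpM2l (w0 i) (@powR_ge_tangent _ _ _ _ p1 (a0 i) s0).
  by congr (_ <= _); ring.
apply: le_trans tangent_sum.
have -> : p * s `^ (p - 1) * s = p * s `^ p.
  by rewrite -mulrA (mulrC _ s) mulr_powRB1//; lra.
have := powR_ge0 s p.
have : 0 <= (p - 1) * (1 - W) by rewrite mulr_ge0//; lra.
set d := _ * _ => d0 sp0.
have := mulr_ge0 d0 sp0; rewrite /d; nra.
Qed.

Lemma powR_div_subr1K (R : realType) (p m : R) :
  1 < p -> 0 <= m -> (m `^ (1 / (p - 1))) `^ (p - 1) = m.
Proof.
by move=> p1 m0; rewrite -powRrM div1r mulVf ?powRr1//; lra.
Qed.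

(** Only one vector of the test family is nonzero, so the other weights,
    whatever their signs, drop out of the inequality. *)
Lemma Fset_weight_gt0 (R : realType) (X : normedModType R) (n : nat) (p : R)
    (mu : 'rV[R]_n) (v : X) (i : 'I_n) :
  v != 0 -> 0 < p -> Fset X p mu -> 0 < mu ord0 i.
Proof.
move=> v0 p0 [mu0 /(_ (fun j => if j == i then v else 0))].
rewrite (bigD1 i)//= eqxx big1 ?addr0; last by move=> j /negbTE ->.
rewrite (bigD1 i)//= eqxx big1 ?addr0; last first.
  by move=> j /negbTE ->; rewrite normr0 powR0 ?mul0r// gt_eqF.
have vp0 : 0 < `|v| `^ p by rewrite powR_gt0// normr_gt0.
rewrite -[leLHS]mulr1 ler_pM2l// => mu_inv_ge1.
by rewrite -invr_gt0 (lt_le_trans ltr01).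
Qed.

(** The choice [x_i = mu_i `^ (1 / (p - 1)) *: v] is the equality case of the
    triangle and Jensen inequalities: the vectors are parallel and the ratios
    [`|x_i| / mu_i `^ (1 / (p - 1))] all agree. *)
Lemma Fset_weight_sum_le1 (R : realType) (X : normedModType R) (n : nat)
    (p : R) (mu : 'rV[R]_n) (v : X) :
  v != 0 -> 1 < p -> Fset X p mu ->
  \sum_(i < n) mu ord0 i `^ (1 / (p - 1)) <= 1.
Proof.
move=> v0 p1 Fmu; have p0 : 0 < p by lra.
have mu_gt0 i := @Fset_weight_gt0 _ _ _ _ _ _ i v0 p0 Fmu.
have [_ /(_ (fun i => mu ord0 i `^ (1 / (p - 1)) *: v))] := Fmu.
rewrite -scaler_suml normrZ.
set S := \sum_(i < n) _.
have S0 : 0 <= S by apply: sumr_ge0 => i _; exact: powR_ge0.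
have -> : \sum_(i < n) `|mu ord0 i `^ (1 / (p - 1)) *: v| `^ p / mu ord0 i =
    S * `|v| `^ p.
  rewrite mulr_suml; apply: eq_bigr => i _.
  rewrite normrZ ger0_norm ?powR_ge0// powRM ?powR_ge0//.
  rewrite -(mulr_powRB1 (powR_ge0 _ _) p0) powR_div_subr1K ?(ltW (mu_gt0 i))//.
  by field; rewrite gt_eqF.
rewrite ger0_norm// powRM// ler_pM2r ?powR_gt0 ?normr_gt0// => Sp_le.
rewrite leNgt; apply/negP => S1.
(* As [S `^ p = S * S `^ (p - 1)], a sum [S > 1] would give [S < S `^ p]. *)
have pB0 : 0 < p - 1 by lra.
have : 1 < S `^ (p - 1).
  by have := gt0_ltr_powR pB0 (ler01 : 1 \is Num.nneg) S0 S1; rewrite powR1.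
move: Sp_le; rewrite -(mulr_powRB1 S0 p0); nra.
Qed.

(** The weights [w_i = mu_i `^ (1 / (p - 1))] are chosen so that
    [w_i * (t / w_i) `^ p = t `^ p / w_i `^ (p - 1) = t `^ p / mu_i], which
    turns the Jensen bound into the required right-hand side. *)
Lemma weights_in_Fset (R : realType) (X : normedModType R) (n : nat) (p : R)
    (mu : 'rV[R]_n) :
  1 < p -> (forall i, 0 < mu ord0 i) ->
  \sum_(i < n) mu ord0 i `^ (1 / (p - 1)) <= 1 -> Fset X p mu.
Proof.
move=> p1 mu_gt0 mu_sum; split=> [i|x]; first by rewrite gt_eqF.
have p0 : 0 < p by lra.
pose w i := mu ord0 i `^ (1 / (p - 1)).
have w_gt0 i : 0 < w i by rewrite powR_gt0.
have norm_split i : `|x i| = w i * (`|x i| / w i).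
  by field; rewrite gt_eqF.
have sum_split : `|\sum_(i < n) x i| <= \sum_(i < n) w i * (`|x i| / w i).
  apply: le_trans (ler_norm_sum _ _ _) _.
  by apply: ler_sum => i _; rewrite -norm_split.
have ratio_ge0 i : 0 <= `|x i| / w i by rewrite divr_ge0// ltW.
apply: (@le_trans _ _ ((\sum_(i < n) w i * (`|x i| / w i)) `^ p)).
  apply: ge0_ler_powR => //; rewrite ?nnegrE//; first exact: ltW.
  by apply: sumr_ge0 => i _; rewrite mulr_ge0// ltW.
apply: le_trans (@powR_sum_subconvex _ _ _ w _ p1 _ ratio_ge0 mu_sum) _.
  by move=> i; exact: ltW.
apply: ler_sum => i _.
rewrite {2}norm_split powRM ?(ltW (w_gt0 i))//.
rewrite -(mulr_powRB1 (ltW (w_gt0 i)) p0) powR_div_subr1K ?(ltW (mu_gt0 i))//.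
by rewrite le_eqVlt; apply/orP; left; apply/eqP; field; rewrite gt_eqF.
Qed.

Theorem theorem2p4 (R : realType) (X : normedModType R)
    (X_nontrivial : exists x : X, x != 0)
    (n : nat) (n_gt0 : (0 < n)%N) (p : R) (p_gt1 : 1 < p) :
  [/\ Fset_neg X p 0 =
        [set mu : 'rV[R]_n | (forall i, 0 < mu ord0 i) /\
           \sum_(i < n) mu ord0 i `^ (1 / (p - 1)) <= 1],
      forall k : nat, (1 <= k <= n)%N ->
        Fset_neg X p k = set0 :> set 'rV[R]_n
    & Fset X p = Fset_neg X p 0 :> set 'rV[R]_n].
Proof.
have [v v0] := X_nontrivial; have p0 : 0 < p by lra.
have no_neg (mu : 'rV[R]_n) :
    Fset X p mu -> #|[pred i : 'I_n | mu ord0 i < 0]| = 0%N.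
  move=> Fmu; apply: eq_card0 => i; rewrite !inE.
  by apply/negbTE; rewrite -leNgt ltW// (@Fset_weight_gt0 _ _ _ _ _ _ i v0 p0).
split.
- apply/seteqP; split=> mu /= [].
    move=> Fmu _; split; last exact: Fset_weight_sum_le1 v0 p_gt1 Fmu.
    by move=> i; exact: Fset_weight_gt0 v0 p0 Fmu.
  move=> mu_gt0 mu_sum; have Fmu := @weights_in_Fset _ X _ _ _ p_gt1 mu_gt0 mu_sum.
  by split=> //; exact: no_neg.
- move=> k /andP[k_gt0 _]; apply/seteqP; split=> // mu [Fmu].
  by rewrite no_neg// => k0; rewrite -k0 in k_gt0.
- apply/seteqP; split=> mu; last by case.
  by move=> Fmu; split=> //; exact: no_neg.
Qed.
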